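(* Let $Q\in\mathcal B$. Then $$\left.\frac{d_-}{d_-x}\mathcal J_x(\Lambda,\phi_0)(Q)\right|_{x=\alpha}=\Theta_\alpha(Q)=\lim_{x\to\alpha,\ x<\alpha}\Theta_x(Q)$$ for all $0<\alpha<1$, where $d_-/d_-x$ denotes the left derivative.
   Context: Setting. Let $X$ be a set, $S:X\to X$ a bijection, $\mathcal A$ a $\sigma$-algebra on $X$, $\mathcal A_0$ the $\sigma$-algebra generated by $\bigcup_{i\ge 0}S^{-i}\mathcal A$, $\mathcal B$ the $\sigma$-algebra generated by $\bigcup_{i\in\mathbb Z}S^{-i}\mathcal A$, and $\mathcal A_m:=S^{-m}\mathcal A_0=\{S^{-m}A:A\in\mathcal A_0\}$ for integers $m\le 0$ (so $\mathcal A_0\subset\mathcal A_{-1}\subset\cdots$). Let $\phi_0$ be a finite positive measure on $\mathcal A_0$, and $\Lambda$ a finite positive measure on $\mathcal A_0$ with $\Lambda\circ S^{-1}=\Lambda$ and $\Lambda\ll\phi_0$; let $Z\ge0$ be an $\mathcal A_0$-measurable version of $d\Lambda/d\phi_0$. For $Q\subset X$ let $\mathcal C(Q)$ be the set of all sequences $(A_m)_{m\le0}$ with $A_m\in\mathcal A_m$ for all $m\le 0$ and $Q\subset\bigcup_{m\le0}A_m$. Define $\Phi(Q):=\inf_{(A_m)\in\mathcal C(Q)}\sum_{m\le0}\phi_0(S^mA_m)$. The symbol $\Lambda$ also denotes $\Lambda(Q):=\inf_{(A_m)\in\mathcal C(Q)}\sum_{m\le0}\Lambda(S^mA_m)$,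 $Q\subset X$; its restriction to $\mathcal B$ is the unique $S$-invariant measure on $\mathcal B$ extending $\Lambda$. Conventions: $0\log0:=0$, $y^x:=e^{x\log y}$ and thus $0^0:=1$; $Z^\alpha\log Z:=0$ where $Z=0$ ($\alpha>0$). For $\epsilon>0$: $\mathcal C^1_\epsilon(Q):=\{(A_m)\in\mathcal C(Q):\sum_{m\le0}\Lambda(S^mA_m)<\Lambda(Q)+\epsilon\}$; $\mathcal C^{0,1}_\epsilon(Q):=\{(A_m)\in\mathcal C^1_\epsilon(Q):\sum_{m\le0}\phi_0(S^mA_m)<\Phi^{\Lambda}(Q)+\epsilon\}$, where $\Phi^{\Lambda}(Q):=\lim_{\epsilon\to0}\inf_{(A_m)\in\mathcal C^1_\epsilon(Q)}\sum_{m\le0}\phi_0(S^mA_m)$ (which equals $\Phi(Q)$). For $\alpha\ge0$: $\mathcal J_\alpha(\Lambda,\phi_0)(Q):=\lim_{\epsilon\to0}\sup_{(A_m)\in\mathcal C^{0,1}_\epsilon(Q)}\sum_{m\le0}\int_{S^mA_m}Z^\alpha d\phi_0$. For $0<\alpha\le1$: $\mathcal F^{\alpha,0,1}_\epsilon(Q):=\{(A_m)\in\mathcal C^{0,1}_\epsilon(Q):\sum_{m\le0}\int_{S^mA_m}Z^\alpha d\phi_0>\mathcal J_\alpha(\Lambda,\phi_0)(Q)-\epsilon\}$ and $\Theta_\alpha(Q):=\lim_{\epsilon\to0}\inf_{(A_m)\in\mathcal F^{\alpha,0,1}_\epsilon(Q)}\sum_{m\le0}\int_{S^mA_m}Z^\alpha\log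 Z\,d\phi_0$. *)

(* Defs.v *)
From HB Require Import structures.
From mathcomp Require Import all_boot all_order all_algebra.
From mathcomp Require Import all_classical all_reals all_analysis.
Set Implicit Arguments.
Unset Strict Implicit.
Unset Printing Implicit Defensive.
Import Order.TTheory GRing.Theory Num.Theory.
Import numFieldNormedType.Exports.
Local Open Scope classical_set_scope.
Local Open Scope ring_scope.
Local Open Scope ereal_scope.

(* S^-i E is the preimage [iter i S @^-1` E], and S^i E is the direct image
   [iter i S @` E]; S is a bijection in every use. *)

Definition future_gens (X : Type) (S : X -> X) (A : set (set X)) :
    set (set X) :=
  \bigcup_(i in [set: nat]) [set iter i S @^-1` E | E in A].

Definition two_sided_gens (X : Type) (S : X -> X) (A : set (set X)) :
    set (set X) :=
  future_gens S A `|` \bigcup_(i in [set: nat]) [set iter i S @` E | E in A].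

(* A_m = S^-m A_0 for m = - n. *)
Definition shifted_algebra (X : Type) (S : X -> X) (A : set (set X))
    (n : nat) : set (set X) :=
  [set iter n S @` E | E in <<s future_gens S A >>].

(* A sequence indexed by the integers m <= 0 is reindexed by n = - m : nat. *)
Definition covers (X : Type) (S : X -> X) (A : set (set X)) (Q : set X) :
    set (nat -> set X) :=
  [set F | (forall n, shifted_algebra S A n (F n)) /\ Q `<=` \bigcup_n F n].

(* sum over m <= 0 of mu (S^m A_m) *)
Definition cover_sum (R : realType) (X : Type) (S : X -> X)
    (mu : set X -> \bar R) (F : nat -> set X) : \bar R :=
  \sum_(0 <= n <oo) mu (iter n S @^-1` F n).

Definition outer (R : realType) (X : Type) (S : X -> X) (A : set (set X))
    (mu : set X -> \bar R) (Q : set X) : \bar R :=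
  ereal_inf [set cover_sum S mu F | F in covers S A Q].

Definition covers1 (R : realType) (X : Type) (S : X -> X) (A : set (set X))
    (Lambda : set X -> \bar R) (Q : set X) (eps : R) : set (nat -> set X) :=
  [set F | covers S A Q F /\
           cover_sum S Lambda F < outer S A Lambda Q + eps%:E].

Definition PhiLambda (R : realType) (X : Type) (S : X -> X) (A : set (set X))
    (Lambda phi0 : set X -> \bar R) (Q : set X) : \bar R :=
  lim (ereal_inf [set cover_sum S phi0 F | F in covers1 S A Lambda Q eps]
       @[eps --> 0%R^'+]).

Definition covers01 (R : realType) (X : Type) (S : X -> X) (A : set (set X))
    (Lambda phi0 : set X -> \bar R) (Q : set X) (eps : R) :
    set (nat -> set X) :=
  [set F | covers1 S A Lambda Q eps F /\
           cover_sum S phi0 F < PhiLambda S A Lambda phi0 Q + eps%:E].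

Definition power_sum (R : realType) (X : pointedType) (S : X -> X)
    (A : set (set X))
    (phi0 : {measure set (g_sigma_algebraType (future_gens S A)) -> \bar R})
    (Z : X -> R) (alpha : R) (F : nat -> set X) : \bar R :=
  cover_sum S (fun E => \int[phi0]_(x in E) (Z x `^ alpha)%:E) F.

(* [ln 0 = 0] in the library, so the integrand is 0 where Z = 0. *)
Definition power_log_sum (R : realType) (X : pointedType) (S : X -> X)
    (A : set (set X))
    (phi0 : {measure set (g_sigma_algebraType (future_gens S A)) -> \bar R})
    (Z : X -> R) (alpha : R) (F : nat -> set X) : \bar R :=
  cover_sum S (fun E => \int[phi0]_(x in E) (Z x `^ alpha * ln (Z x))%:E) F.

Definition calJ (R : realType) (X : pointedType) (S : X -> X)
    (A : set (set X))
    (Lambda phi0 : {measure set (g_sigma_algebraType (future_gens S A))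
                    -> \bar R})
    (Z : X -> R) (Q : set X) (alpha : R) : \bar R :=
  lim (ereal_sup [set power_sum phi0 Z alpha F
                 | F in covers01 S A Lambda phi0 Q eps] @[eps --> 0%R^'+]).

Definition coversF (R : realType) (X : pointedType) (S : X -> X)
    (A : set (set X))
    (Lambda phi0 : {measure set (g_sigma_algebraType (future_gens S A))
                    -> \bar R})
    (Z : X -> R) (Q : set X) (alpha : R) (eps : R) : set (nat -> set X) :=
  [set F | covers01 S A Lambda phi0 Q eps F /\
           calJ Lambda phi0 Z Q alpha - eps%:E < power_sum phi0 Z alpha F].

Definition Theta (R : realType) (X : pointedType) (S : X -> X)
    (A : set (set X))
    (Lambda phi0 : {measure set (g_sigma_algebraType (future_gens S A))
                    -> \bar R})
    (Z : X -> R) (Q : set X) (alpha : R) : \bar R :=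
  lim (ereal_inf [set power_log_sum phi0 Z alpha F
                 | F in coversF Lambda phi0 Z Q alpha eps]
       @[eps --> 0%R^'+]).

(* The extended-real-valued f is finite at a and on a left neighbourhood of a,
   and has the (finite) left derivative l at a. *)
Definition is_left_derivative (R : realType) (f : R -> \bar R) (a : R)
    (l : \bar R) : Prop :=
  [/\ f a \is a fin_num, (\forall x \near a^'-, f x \is a fin_num),
      l \is a fin_num &
      ((fine (f x) - fine (f a)) / (x - a))%R @[x --> a^'-] --> fine l].

(* Main.v *)
Require Import Defs.
From HB Require Import structures.
From mathcomp Require Import all_boot all_order all_algebra.
From mathcomp Require Import all_classical all_reals all_analysis.
From mathcomp Require Import measurable_realfun.
From mathcomp Require Import ring lra.
Import Order.TTheory GRing.Theory Num.Theory.
Import numFieldNormedType.Exports.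
Local Open Scope classical_set_scope.
Local Open Scope ring_scope.

(* A cover F yields the measure mu_F, the sum over n of phi0 restricted to
   S^-n F_n, and J_x(F) is the moment of order x of Z under mu_F: a convex
   function of x whose derivative is the sum of the integrals of Z^x log Z.
   Since l^2 e^(xl) <= C (1 + e^l) with C locally bounded in x, its second
   derivative is bounded by the masses of F for phi0 and Lambda, uniformly over
   the covers at hand.  The limit of suprema J is therefore an upper envelope of
   uniformly smooth convex functions: Theta_x is a subgradient of J at x, and a
   cover near-optimal at x is near-optimal at alpha when x is close to alpha,
   which gives the left derivative and the left continuity.

   All this needs Phi^Lambda(Q) to be finite, i.e. covers of nearly minimal
   Lambda-mass and bounded phi0-mass.  Grouping the tail of a Lambda-optimal
   cover into blocks of fast decreasing Lambda-mass bounds the phi0-mass on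
   {Z > 0}; the shifts of the null set {Z = 0} are covered separately. *)

(** * Powers *)

(** The tangent inequality at [-t] gives [e^t - 1 <= t e^t], so the left side is at most
    [t (e^t - 1)], and [|e^t - 1| <= |t| (1 + e^t)]. *)
Lemma expR_sub1D_le (R : realType) (t : R) :
  expR t - 1 - t <= t ^+ 2 * (1 + expR t).
Proof.
have h1 := expR_ge1Dx t; have h2 := expR_ge1Dx (- t).
have e0 := expR_gt0 t.
have h3 : expR t - 1 <= t * expR t.
  have : (1 + - t) * expR t <= expR (- t) * expR t by rewrite ler_pM2r.
  by rewrite -expRD addNr expR0; lra.
by case: (lerP 0 t) => t0; nra.
Qed.

(** Squaring [1 + cs/2 <= e^(cs/2)] gives [(cs)^2 / 4 <= e^(cs)]. *)
Lemma sqr_le_expR (R : realType) (c s : R) : 0 < c -> 0 <= s ->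
  s ^+ 2 <= 4 / c ^+ 2 * expR (c * s).
Proof.
move=> c0 s0.
have -> : c * s = c * s / 2 + c * s / 2 by field.
have h := expR_ge1Dx (c * s / 2); set E := expR _ in h *.
have cs0 : 0 <= c * s by rewrite mulr_ge0 // ltW.
have h' : (c * s) ^+ 2 <= 4 * expR (c * s / 2 + c * s / 2).
  by rewrite expRD -/E; nra.
have -> : s ^+ 2 = (c ^+ 2)^-1 * (c * s) ^+ 2 by field; lra.
rewrite [4 / _]mulrC -[X in _ <= X]mulrA; apply: ler_wpM2l => //.
by rewrite invr_ge0 sqr_ge0.
Qed.

(** The fractions are the constants of [sqr_le_expR] at the rates [x] (for [l < 0]) and [1 - x] (for
    [l >= 0]). They blow up only at the ends of the interval (0, 1). *)
Definition pow_log_const (R : realType) (x : R) : R := 1 + 4 / x ^+ 2 + 4 / (1 - x) ^+ 2.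

Lemma pow_log_const_ge1 (R : realType) (x : R) : 0 < x < 1 -> 1 <= pow_log_const R x.
Proof.
move=> /andP[x0 x1]; rewrite /pow_log_const -addrA lerDl.
by rewrite addr_ge0 // divr_ge0 // sqr_ge0.
Qed.

Lemma expRM_le (R : realType) (x l : R) : 0 < x < 1 ->
  expR (x * l) <= 1 + expR l.
Proof.
move=> /andP[x0 x1]; have e0 := expR_gt0 l.
case: (lerP 0 l) => l0.
  have : expR (x * l) <= expR l by rewrite ler_expR; nra.
  lra.
have : expR (x * l) <= expR 0 by rewrite ler_expR; nra.
rewrite expR0; lra.
Qed.

(** For [l >= 0] the square is absorbed by [e^((1-x) l)], leaving [e^l]; for [l < 0] it is absorbed
    by [e^(-x l)], leaving 1. *)
Lemma sqr_expRM_le (R : realType) (x l : R) : 0 < x < 1 ->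
  (1 + l ^+ 2) * expR (x * l) <= pow_log_const R x * (1 + expR l).
Proof.
move=> x01; have h := expRM_le R x l x01; move/andP: x01 => [x0 x1].
rewrite /pow_log_const mulrDl mul1r -addrA mulrDl mul1r lerD // {h}.
have a0 : 0 <= 4 / x ^+ 2 by rewrite divr_ge0 // sqr_ge0.
have b0 : 0 <= 4 / (1 - x) ^+ 2 by rewrite divr_ge0 // sqr_ge0.
set a := 4 / _ in a0 *; set b := 4 / _ in b0 *.
have el := expR_gt0 l.
case: (lerP 0 l) => l0.
  have x1' : 0 < 1 - x by lra.
  have h := sqr_le_expR R (1 - x) l x1' l0.
  have : l ^+ 2 * expR (x * l) <= b * expR ((1 - x) * l) * expR (x * l).
    by rewrite ler_pM2r ?expR_gt0.
  rewrite -mulrA -expRD (_ : (1 - x) * l + x * l = l); last by ring.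
  nra.
have ml0 : 0 <= - l by lra.
have h := sqr_le_expR R x (- l) x0 ml0.
have : (- l) ^+ 2 * expR (x * l) <= a * expR (x * - l) * expR (x * l).
  by rewrite ler_pM2r ?expR_gt0.
rewrite -mulrA -expRD (_ : x * - l + x * l = 0) ?expR0 ?sqrrN; last by ring.
nra.
Qed.

Lemma powR_le1D (R : realType) (x z : R) : 0 < x < 1 -> 0 <= z ->
  z `^ x <= 1 + z.
Proof.
move=> x01; rewrite le_eqVlt => /predU1P[<-|z0].
  by rewrite powR0 ?addr0 //; case/andP: x01 => /lt0r_neq0.
by rewrite /powR gt_eqF // -[X in 1 + X]lnK // expRM_le.
Qed.

(** With [l = ln z], this is [sqr_expRM_le] and [|l| <= 1 + l^2]. At [z = 0] the left side is 0
    because [ln 0 = 0]. *)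
Lemma powR_ln_bound (R : realType) (x z : R) : 0 < x < 1 -> 0 <= z ->
  `|z `^ x * ln z| <= pow_log_const R x * (1 + z).
Proof.
move=> x01; rewrite le_eqVlt => /predU1P[<-|z0].
  rewrite ln0 // mulr0 normr0 addr0 mulr1.
  exact: le_trans ler01 (pow_log_const_ge1 _ _ x01).
rewrite /powR gt_eqF // -[X in 1 + X]lnK //; set l := ln z.
apply: le_trans (sqr_expRM_le R x l x01).
rewrite normrM (gtr0_norm (expR_gt0 _)) mulrC ler_pM2r ?expR_gt0 //.
by case: (ger0P l) => l0; nra.
Qed.

(** Convexity of the exponent map: dividing by [e^(xl)] with [l = ln z] leaves [1 + t <= e^t] at
    [t = (y - x) l]. *)
Lemma powR_tangent_le (R : realType) (x y z : R) :
  0 < x < 1 -> 0 < y < 1 -> 0 <= z ->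
  z `^ x + z `^ x * ln z * (y - x) <= z `^ y.
Proof.
move=> /andP[x0 x1] /andP[y0 y1]; rewrite le_eqVlt => /predU1P[<-|z0].
  by rewrite !powR0 ?mul0r ?addr0 ?gt_eqF.
rewrite /powR gt_eqF //; set l := ln z.
have -> : y * l = x * l + (y - x) * l by ring.
rewrite expRD -mulrA -{1}(mulr1 (expR (x * l))) -mulrDr ler_pM2l ?expR_gt0 //.
by rewrite mulrC expR_ge1Dx.
Qed.

(** The remainder is [e^(xl) (e^t - 1 - t)] with [t = (y - x) l]. Its bound [e^(xl) t^2 (1 + e^t)]
    splits into [l^2 e^(xl)] and [l^2 e^(yl)], whence one constant for each of the two exponents. *)
Lemma powR_le_taylor (R : realType) (x y z : R) :
  0 < x < 1 -> 0 < y < 1 -> 0 <= z ->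
  z `^ y <= z `^ x + z `^ x * ln z * (y - x)
            + (y - x) ^+ 2 * (pow_log_const R x + pow_log_const R y) * (1 + z).
Proof.
move=> x01 y01.
have cx := pow_log_const_ge1 R x x01; have cy := pow_log_const_ge1 R y y01.
rewrite le_eqVlt => /predU1P[<-|z0].
  have [x0 y0] : x != 0 /\ y != 0.
    by split; apply: lt0r_neq0; [case/andP: x01|case/andP: y01].
  rewrite !powR0 // !mul0r !addr0 !add0r mulr1.
  by rewrite mulr_ge0 ?sqr_ge0 //; lra.
rewrite /powR gt_eqF // -[X in 1 + X]lnK //; set l := ln z.
have hx := sqr_expRM_le R x l x01; have hy := sqr_expRM_le R y l y01.
have -> : y * l = x * l + (y - x) * l by ring.
set d := y - x.
have ex := expR_gt0 (x * l).
have ht := expR_sub1D_le R (d * l).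
have -> : expR (x * l + d * l) = expR (x * l) + expR (x * l) * l * d +
   expR (x * l) * (expR (d * l) - 1 - d * l) by rewrite expRD; ring.
rewrite lerD2l.
apply: (@le_trans _ _ (expR (x * l) * ((d * l) ^+ 2 * (1 + expR (d * l))))).
  by rewrite ler_pM2l.
have -> : expR (x * l) * ((d * l) ^+ 2 * (1 + expR (d * l))) =
  d ^+ 2 * (l ^+ 2 * expR (x * l) + l ^+ 2 * expR (y * l)).
  have -> : y * l = x * l + d * l by rewrite /d; ring.
  by rewrite expRD; ring.
rewrite -mulrA ler_wpM2l ?sqr_ge0 //.
have ey := expR_gt0 (y * l).
nra.
Qed.

(** * Upper envelopes of smooth convex functions *)

Section envelope.
(** In the application [D e] consists of the covers optimal up to [e], [f F] is the moment function
    of the cover [F] and [g F] its derivative, [J] is the limit of suprema of [f], and [Th] the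
    limit of infima of [g] over covers nearly maximal for [f]. *)
Context (R : realType) (T : Type) (D : R -> set T) (f g : T -> R -> R)
  (J Th : R -> R).
Hypothesis D_mono : forall e e', 0 < e -> e <= e' -> D e `<=` D e'.
Hypothesis f_tangent : forall F x y, D 1 F -> 0 < x < 1 -> 0 < y < 1 ->
  f F x + g F x * (y - x) <= f F y.
Hypothesis f_taylor : forall a, 0 < a < 1 -> exists2 K, 0 <= K &
  forall F y, D 1 F -> a / 2 <= y <= a ->
  f F y <= f F a + g F a * (y - a) + K * (y - a) ^+ 2.
Hypothesis g_bound : forall a, 0 < a < 1 -> exists2 K, 0 <= K &
  forall F y, D 1 F -> a / 2 <= y <= a -> - K <= g F y.
Hypothesis J_ub : forall x e, 0 < x < 1 -> 0 < e -> exists2 d, 0 < d &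
  forall F, D d F -> f F x < J x + e.
Hypothesis Th_attained : forall x e, 0 < x < 1 -> 0 < e ->
  exists F, [/\ D e F, J x - e < f F x & g F x < Th x + e].
Hypothesis Th_lb : forall x e, 0 < x < 1 -> 0 < e -> exists2 d, 0 < d &
  forall F, D d F -> J x - d < f F x -> Th x - e < g F x.

(** A near-maximiser [F] at [x] has slope close to [Th x], and its tangent line at [x] lies below
    [f F y], hence below [J y] up to a small error. The slope is controlled from both sides since
    [y - x] may have either sign. *)
Lemma envelope_subgradient x y : 0 < x < 1 -> 0 < y < 1 ->
  J x + Th x * (y - x) <= J y.
Proof.
move=> x01 y01; apply/ler_addgt0Pr => e e0.
(* The error is one [e'] for [J] at [x], one for [J] at [y], and [e' * |y - x|] for the slope. *)
pose e' := e / (2 + `|y - x|).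
have n0 := normr_ge0 (y - x).
have p0 : 0 < 2 + `|y - x| by lra.
have e'0 : 0 < e' by rewrite divr_gt0.
have [d1 d10 h1] := J_ub y e' y01 e'0.
have [d2 d20 h2] := Th_lb x e' x01 e'0.
pose d := Num.min (Num.min e' 1) (Num.min d1 d2).
have d0 : 0 < d by rewrite !lt_min e'0 ltr01 d10 d20.
have [de' d1' dd1 dd2] : [/\ d <= e', d <= 1, d <= d1 & d <= d2].
  by split; rewrite /d !ge_min lexx ?orbT.
have [F [DF JF gF]] := Th_attained x d x01 d0.
have hy := h1 F (D_mono _ _ d0 dd1 _ DF).
have JF2 : J x - d2 < f F x by lra.
have hg := h2 F (D_mono _ _ d0 dd2 _ DF) JF2.
have ht := f_tangent F x y (D_mono _ _ d0 d1' _ DF) x01 y01.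
have ee : e = e' * 2 + e' * `|y - x| by rewrite /e'; field; lra.
by case: (ger0P (y - x)) ee => yx ee; nra.
Qed.

(** The upper bound is the subgradient inequality at [a]. For the lower one, a near-maximiser at [x]
    is still nearly maximal at [a], so its slope there is almost at least [Th a], and the Taylor
    bound at [a] carries this over to the difference quotient. *)
Lemma envelope_left_derivative a e : 0 < a < 1 -> 0 < e ->
  exists2 d, 0 < d & forall x, a - d < x < a -> 0 < x < 1 ->
    Th a - e <= (J x - J a) / (x - a) <= Th a.
Proof.
move=> a01 e0.
have e20 : 0 < e / 2 by lra.
have [d1 d10 h1] := Th_lb a (e / 2) a01 e20.
have [K K0 hK] := f_taylor a a01.
have [K' K'0 hK'] := g_bound a a01.
have n0 := normr_ge0 (Th a).
(* The three terms keep [x] in [[a/2, a]], make the Taylor error at most [(e/2) (a - x)], and keep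
   the loss of optimality between [x] and [a] below [d1/2]. Each [+ 1] keeps a denominator
   positive. *)
pose d := Num.min (a / 2) (Num.min (e / 2 / (K + 1)) (d1 / 2 / (`|Th a| + K' + 1))).
have d0 : 0 < d.
  have /andP[a0 _] := a01.
  rewrite !lt_min; apply/and3P; split; first by lra.
  - by apply: divr_gt0; lra.
  - by apply: divr_gt0; lra.
have [da de dd1] : [/\ d <= a / 2, d * (K + 1) <= e / 2
    & d * (`|Th a| + K' + 1) <= d1 / 2].
  split; first by rewrite /d ge_min lexx.
  - by rewrite -ler_pdivlMr; [rewrite /d !ge_min lexx orbT|lra].
  - by rewrite -ler_pdivlMr; [rewrite /d !ge_min lexx !orbT|lra].
exists d => // x /andP[dx xa] x01.
have ax : 0 < a - x by lra.
have -> : (J x - J a) / (x - a) = (J a - J x) / (a - x) by field; lra.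
rewrite ler_pdivlMr // ler_pdivrMr //.
have sub := envelope_subgradient a x a01 x01.
have [k1 k2] : K * (a - x) <= e / 2 /\ (`|Th a| + K') * (a - x) < d1 / 2.
  split; nra.
apply/andP; split; last by lra.
suff : (Th a - e) * (a - x) + J x <= J a by lra.
(* The errors in choosing [F] are not proportional to [a - x], so [F] is chosen after [x], within an
   arbitrary [eta0]. *)
apply/ler_addgt0Pr => eta0 eta00.
pose eta := Num.min (eta0 / 2) (Num.min (d1 / 2) 1).
have eta_gt0 : 0 < eta by rewrite !lt_min; apply/and3P; split; lra.
have [et0 et1 et2] : [/\ eta <= eta0 / 2, eta <= d1 / 2 & eta <= 1].
  by split; rewrite /eta !ge_min lexx ?orbT.
have [d2 d20 h2] := J_ub a eta a01 eta_gt0.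
pose m := Num.min eta d2.
have m0 : 0 < m by rewrite lt_min eta_gt0.
have [m1 m2] : m <= eta /\ m <= d2 by split; rewrite /m ge_min lexx ?orbT.
have [F [DF JF _]] := Th_attained x m x01 m0.
have DF1 : D 1 F by apply: D_mono DF => //; lra.
have xa2 : a / 2 <= x <= a by apply/andP; split; lra.
have aJ : f F a < J a + eta by apply: h2; apply: D_mono DF.
have ht := f_tangent F x a DF1 x01 a01.
have hg := hK' F x DF1 xa2.
have hf := hK F x DF1 xa2.
have tn : Th a <= `|Th a| by apply: ler_norm.
have tJ : J x - m + - K' * (a - x) <= f F a by nra.
(* The subgradient inequality at [a] bounds [J x] below by [J a - Th a * (a - x)]; so [F] is optimal
   at [a] up to [d1], as [h1] requires. *)
have JFa : J a - d1 < f F a by nra.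
have gFa : Th a - e / 2 < g F a by apply: h1 => //; apply: D_mono DF => //; lra.
nra.
Qed.

(** Subgradients are monotone, which gives the upper bound. For the lower one, fix [y < a] whose
    difference quotient to [a] is nearly [Th a]; for [x] near [a], [Th x] is at least the quotient
    between [y] and [x], which is close to it. *)
Lemma envelope_slope_left_continuous a e : 0 < a < 1 -> 0 < e ->
  exists2 d, 0 < d & forall x, a - d < x < a -> 0 < x < 1 ->
    Th a - e <= Th x <= Th a.
Proof.
move=> a01 e0.
have e20 : 0 < e / 2 by lra.
have [d1 d10 h1] := envelope_left_derivative a (e / 2) a01 e20.
have a0 : 0 < a by case/andP: a01.
have a1 : a < 1 by case/andP: a01.
pose y := a - Num.min (d1 / 2) (a / 2).
have [yd ya y0] : [/\ a - d1 < y, y < a & 0 < y].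
  have : 0 < Num.min (d1 / 2) (a / 2) by rewrite lt_min; apply/andP; split; lra.
  have : Num.min (d1 / 2) (a / 2) <= d1 / 2 by rewrite ge_min lexx.
  have : Num.min (d1 / 2) (a / 2) <= a / 2 by rewrite ge_min lexx orbT.
  by rewrite /y; split; lra.
have y01 : 0 < y < 1 by apply/andP; split; lra.
have ydd : a - d1 < y < a by apply/andP; split; lra.
have /andP[hy _] := h1 y ydd y01.
have {hy} hy : (Th a - e / 2) * (a - y) <= J a - J y.
  move: hy; have -> : (J y - J a) / (y - a) = (J a - J y) / (a - y) by field; lra.
  by rewrite ler_pdivlMr //; lra.
have n0 := normr_ge0 (Th a); have nT := ler_norm (Th a).
have nT' : - Th a <= `|Th a| by rewrite -normrN ler_norm.
pose c := 2 * `|Th a| + e.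
have c0 : 0 < c by rewrite /c; lra.
(* The first term keeps [x] at distance at least [(a - y) / 2] from [y]; the second lets
   [(e/2) (x - y)] absorb the error of replacing [a] by [x], bounded in terms of [c * (a - x)]. *)
pose d := Num.min ((a - y) / 2) (e / 2 * ((a - y) / 2) / c).
have d0 : 0 < d.
  rewrite lt_min; apply/andP; split; first by lra.
  by rewrite divr_gt0 // mulr_gt0 //; lra.
have dy : d <= (a - y) / 2 by rewrite /d ge_min lexx.
have dc : d * c <= e / 2 * ((a - y) / 2).
  by rewrite -ler_pdivlMr // /d ge_min lexx orbT.
exists d => // x /andP[dx xa] x01.
have s1 := envelope_subgradient x a x01 a01.
have s2 := envelope_subgradient a x a01 x01.
have s3 := envelope_subgradient x y x01 y01.
have xy : (a - y) / 2 <= x - y by lra.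
have ax : 0 < a - x by lra.
apply/andP; split.
  have xy0 : 0 < x - y by lra.
  rewrite -(ler_pM2r xy0).
  have : (a - x) * c <= e / 2 * (x - y) by nra.
  rewrite /c => hc.
  nra.
rewrite -(ler_pM2r ax); lra.
Qed.

End envelope.

Local Open Scope ereal_scope.

(** * Covers *)

Section shifts.
Context (X : pointedType) (S : X -> X) (A : set (set X)).
Local Notation T := (g_sigma_algebraType (future_gens S A)).

(** A preimage under [S] sends the generator [S^-i B] to the generator [S^-(i+1) B]. *)
Lemma measurable_preimage_shift (E : set T) :
  measurable E -> measurable (S @^-1` E : set T).
Proof.
suff : <<s future_gens S A >> `<=`
    [set E | <<s future_gens S A >> (S @^-1` E)] by apply.
apply: smallest_sub.
  split => /=.
  - by rewrite preimage_set0; exact: sigma_algebra0.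
  - by move=> B mB; rewrite setTD preimage_setC; exact: sigma_algebraC.
  - by move=> F mF; rewrite preimage_bigcup; exact: sigma_algebra_bigcup.
move=> _ [i _ [B AB <-]]; apply: sub_sigma_algebra.
by exists i.+1 => //; exists B => //; apply/seteqP; split=> x /=; rewrite -iterSr.
Qed.

Lemma measurable_preimage_iter n (E : set T) :
  measurable E -> measurable (iter n S @^-1` E : set T).
Proof.
elim: n E => // n ih E mE.
have := measurable_preimage_shift _ (ih _ mE).
by congr measurable; apply/seteqP; split=> x /=; rewrite -iterSr.
Qed.

Hypothesis bijS : bijective S.

Lemma iter_surj n x : exists y, iter n S y = x.
Proof.
have [S' _ SK] := bijS.
exists (iter n S' x); elim: n x => // n ih x.
by rewrite iterS iterSr ih SK.
Qed.

Lemma iter_inj n : injective (iter n S).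
Proof. by elim: n => // n ih x y; rewrite !iterS => /(bij_inj bijS)/ih. Qed.

Lemma image_iterK n (E : set X) : iter n S @^-1` (iter n S @` E) = E.
Proof.
apply/seteqP; split=> x /=; last by exists x.
by move=> [y Ey /iter_inj <-].
Qed.

(** Expresses membership through the preimage, the set that [cover_sum] measures. *)
Lemma shifted_algebraP n (F : set X) :
  shifted_algebra S A n F <-> measurable (iter n S @^-1` F : set T).
Proof.
split; first by move=> [E mE <-]; rewrite image_iterK.
move=> mF; exists (iter n S @^-1` F) => //.
apply/seteqP; split=> [_ [y Fy <-] //|x Fx].
by have [y yx] := iter_surj n x; exists y => //=; rewrite yx.
Qed.

Context (R : realType).
Implicit Types mu : {measure set T -> \bar R}.

Lemma cover_sumU mu (F G : nat -> set X) :
  (forall n, shifted_algebra S A n (F n)) ->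
  (forall n, shifted_algebra S A n (G n)) ->
  (forall n, shifted_algebra S A n (F n `|` G n)) /\
  cover_sum S mu (fun n => F n `|` G n) <= cover_sum S mu F + cover_sum S mu G.
Proof.
move=> mF mG; split.
  by move=> n; apply/shifted_algebraP; rewrite preimage_setU;
    apply: measurableU; exact/shifted_algebraP.
rewrite /cover_sum -nneseriesD; last 2 first.
- by move=> *; exact: measure_ge0.
- by move=> *; exact: measure_ge0.
apply: lee_nneseries => n *; first exact: measure_ge0.
by rewrite preimage_setU; apply: measureU2; exact/shifted_algebraP.
Qed.

(** The image [S^(k i) E_i] is placed at index [k i], where the cover sum sees [E_i] itself. Sets
    sharing an index are united, and subadditivity and an exchange of summations bound the sum. One
    [F] serves all measures, so it can be used for [phi] and [Lam] at once. *)
Lemma cover_of_family (E : nat -> set T) (k : nat -> nat) :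
  (forall i, measurable (E i)) ->
  exists F, [/\ forall n, shifted_algebra S A n (F n),
    forall i y, E i y -> (\bigcup_n F n) (iter (k i) S y) &
    forall mu, cover_sum S mu F <= \sum_(i <oo) mu (E i)].
Proof.
move=> mE.
pose F n : set X := \bigcup_(i in [set i | k i = n]) (iter n S @` E i).
have FE n : iter n S @^-1` F n = \bigcup_(i in [set i | k i = n]) E i.
  by rewrite preimage_bigcup; apply: eq_bigcupr => i _; rewrite image_iterK.
exists F; split.
- by move=> n; apply/shifted_algebraP; rewrite FE; exact: bigcup_measurable.
- by move=> i y Ey; exists (k i) => //; exists i => //; exists y.
move=> mu; rewrite /cover_sum.
pose a n i : \bar R := if k i == n then mu (E i) else 0.
have a0 n i : 0 <= a n i by rewrite /a; case: ifP.
apply: (@le_trans _ _ (\sum_(n <oo) \sum_(i <oo) a n i)).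
  apply: lee_nneseries => n *; first exact: measure_ge0.
  rewrite FE; pose G i : set T := if k i == n then E i else set0.
  have mG i : measurable (G i) by rewrite /G; case: ifP.
  apply: (@le_trans _ _ (\sum_(i <oo) mu (G i))).
    apply: measure_sigma_subadditive => //.
      by apply: bigcup_measurable.
    by move=> y [i /= ki Ey]; exists i => //; rewrite /G ki eqxx.
  by apply: lee_nneseries => i *; rewrite /G /a; case: ifP => //; rewrite measure0.
rewrite nneseries_interchange //; apply: lee_nneseries => i *.
  by apply: nneseries_ge0.
rewrite (@nneseriesD1 _ _ (k i) xpredT) // [a _ _]/a eqxx eseries0 ?adde0 //.
by move=> n _ /= /negPf nk; rewrite /a eq_sym nk.
Qed.

Lemma cover_of_set (E : set T) n : measurable E ->
  exists F, [/\ forall n, shifted_algebra S A n (F n),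
    forall y, E y -> (\bigcup_n F n) (iter n S y) &
    forall mu, cover_sum S mu F <= mu E].
Proof.
move=> mE; pose G i : set T := if i == 0%N then E else set0.
have mG i : measurable (G i) by rewrite /G; case: ifP.
have [F [F1 F2 F3]] := cover_of_family G (fun=> n) mG.
exists F; split => //; first by move=> y Ey; apply: (F2 0%N).
move=> mu; apply: le_trans (F3 mu) _.
rewrite (@nneseriesD1 _ _ 0%N xpredT) //= eseries0 ?adde0 //.
by move=> i _ /negPf; rewrite /G => ->; rewrite measure0.
Qed.

End shifts.

Lemma cvge0_near_lt (R : realType) (u : nat -> \bar R) (e : R) :
  u n @[n --> \oo] --> 0 -> (0 < e)%R -> \forall n \near \oo, u n < e%:E.
Proof.
move=> /fine_cvgP[fu /cvgrPdist_lt /(_ e) h] e0.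
have {}h := h e0; near=> n.
have fn : u n \is a fin_num by near: n.
rewrite -(fineK fn) lte_fin.
have : (`|0 - fine (u n)| < e)%R by near: n.
by rewrite sub0r normrN; apply: le_lt_trans; exact: ler_norm.
Unshelve. all: by end_near. Qed.

(** * Absolute continuity on the set where the density is positive *)

Section abs_cont.
Context d (T : measurableType d) (R : realType)
  (phi Lam : {finite_measure set T -> \bar R}) (Z : T -> R).
Hypothesis mZ : measurable_fun [set: T] Z.
Hypothesis Z_density : forall E : set T, measurable E ->
  Lam E = \int[phi]_(x in E) (Z x)%:E.

Lemma measurable_sub_gt (r : R) : measurable [set x | (r < Z x)%R].
Proof.
rewrite -[X in measurable X]setTI.
have -> : [set x | (r < Z x)%R] = Z @^-1` `]r, +oo[%classic.
  by apply/seteqP; split=> x /=; rewrite in_itv/= andbT.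
exact: mZ.
Qed.

(** Where [Z > 1/(n+1)], [phi] is at most [(n+1) Lam]. The remaining sets [0 < Z <= 1/(n+1)]
    decrease to the empty set, so their [phi]-mass tends to 0. *)
Lemma abs_cont_on_support (e : R) : (0 < e)%R ->
  exists2 dl, (0 < dl)%R & forall E : set T, measurable E -> Lam E <= dl%:E ->
    phi (E `&` [set x | (0 < Z x)%R]) <= e%:E.
Proof.
move=> e0.
pose B n : set T := [set x | (0 < Z x)%R] `\` [set x | (n.+1%:R^-1 < Z x)%R].
have mB n : measurable (B n) by apply: measurableD; exact: measurable_sub_gt.
have B0 : \bigcap_n B n = set0.
  rewrite -subset0 => x Bx.
  have [Zx _] := Bx 0%N I.
  have [n _ hn] := (near_infty_natSinv_lt (PosNum Zx)).
  have [_ /=] := Bx n I; apply.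
  by have /= := hn n (leqnn n).
have B_cvg : (phi \o B) n @[n --> \oo] --> (0 : \bar R).
  rewrite -(measure0 phi) -B0; apply: nonincreasing_cvg_mu => //.
  - by rewrite -ge0_fin_numE ?fin_num_measure //; exact: measurable_sub_gt.
  - by rewrite B0.
  - move=> n m nm; apply/subsetPset; apply: setDS => x /= ; apply: le_lt_trans.
    by rewrite lef_pV2 ?posrE // ler_nat.
have e20 : (0 < e / 2)%R by lra.
have [n _ hn] := cvge0_near_lt _ _ _ B_cvg e20.
have {}hn : phi (B n) < (e / 2)%:E := hn n (leqnn n).
have n0 : (0 < n.+1%:R :> R)%R by [].
exists (n.+1%:R^-1 * (e / 2))%R; first by rewrite mulr_gt0 ?invr_gt0.
move=> E mE LE; pose C := E `&` [set x | (n.+1%:R^-1 < Z x)%R].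
have mC : measurable C by apply: measurableI => //; exact: measurable_sub_gt.
have hC : phi C <= (e / 2)%:E.
  have : (n.+1%:R^-1)%:E * phi C <= (n.+1%:R^-1 * (e / 2))%:E.
    apply: le_trans LE; apply: (@le_trans _ _ (Lam C)); last first.
      by apply: le_measure; rewrite ?inE //; exact: subIsetl.
    rewrite Z_density // -integral_cst //.
    apply: ge0_le_integral => //=.
    - by apply/measurable_EFinP; apply: measurable_funTS.
    - by move=> x [_ h]; rewrite lee_fin ltW.
  have fC : phi C \is a fin_num by apply: fin_num_measure.
  by rewrite -(fineK fC) -EFinM !lee_fin ler_pM2l // invr_gt0.
apply: (@le_trans _ _ (phi C + phi (B n))); last first.
  have -> : e = (e / 2 + e / 2)%R by field.
  by rewrite EFinD leeD // ltW.
apply: le_trans (measureU2 _ mC (mB n)).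
apply: le_measure; rewrite ?inE.
- by apply: measurableI => //; exact: measurable_sub_gt.
- exact: measurableU.
- move=> x [Ex Zx]; case: (ltP n.+1%:R^-1%R (Z x)) => h; [left|right] => //.
  by split => //=; apply/negP; rewrite -leNgt.
Qed.

End abs_cont.

(** * Covers of bounded mass *)

Section invariant.
Context (X : pointedType) (S : X -> X) (A : set (set X)) (R : realType).
Local Notation T := (g_sigma_algebraType (future_gens S A)).
Context (phi Lam : {finite_measure set T -> \bar R}).
Hypothesis bijS : bijective S.
Hypothesis Lam_inv : forall E : set T, measurable E -> Lam (S @^-1` E) = Lam E.

Lemma Lam_preimage_iter n (E : set T) : measurable E ->
  Lam (iter n S @^-1` E) = Lam E.
Proof.
elim: n E => // n ih E mE.
rewrite -[RHS]ih // -[RHS]Lam_inv; last exact: measurable_preimage_iter.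
by congr (Lam _); apply/seteqP; split=> x /=; rewrite -iterSr.
Qed.

(* Covering each S^n V at index n could cost infinite [phi]-mass.  Instead, the
   invariant set of points visiting V infinitely often is placed at index 0, and
   what remains of S^n V at an index so late that its [phi]-mass is summable:
   the sets of points visiting V finitely often, and last at time k or later,
   decrease to the empty set as k grows. *)
Lemma null_cover (V : set T) : measurable V -> Lam V = 0 ->
  exists F, [/\ forall n, shifted_algebra S A n (F n),
    forall n y, V y -> (\bigcup_n F n) (iter n S y),
    cover_sum S phi F <= phi setT + 1 & cover_sum S Lam F <= 0].
Proof.
move=> mV V0.
pose U k : set T := \bigcup_j (iter (k + j) S @^-1` V).
have mU k : measurable (U k).
  by apply: bigcupT_measurable => j; exact: measurable_preimage_iter.
have US k n : iter n S @^-1` U k = U (n + k)%N.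
  rewrite /U preimage_bigcup; apply: eq_bigcupr => j _.
  have -> : (n + k + j = k + j + n)%N by rewrite -addnA addnC.
  by apply/seteqP; split=> x /=; rewrite -iterD.
have U_noninc k n : (k <= n)%N -> U n `<=` U k.
  move=> kn x [j _ Vx]; exists (n - k + j)%N => //.
  by rewrite /= addnA subnKC.
have U0 k : Lam (U k) = 0.
  apply/eqP; rewrite eq_le measure_ge0 andbT.
  apply: (@le_trans _ _ (\sum_(j <oo) Lam (iter (k + j) S @^-1` V : set T))).
    apply: measure_sigma_subadditive => // j.
    exact: measurable_preimage_iter.
  by rewrite eseries0 // => j _ _; rewrite /= Lam_preimage_iter.
pose W : set T := \bigcap_k U k.
have mW : measurable W by apply: bigcapT_measurable.
have W0 : Lam W = 0.
  have WU : W `<=` U 0%N by move=> x; apply.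
  exact: subset_measure0 WU (U0 0%N).
have WS n y : W y -> W (iter n S y).
  move=> Wy k _; have := Wy (n + k)%N I.
  by rewrite -US.
pose B k : set T := U k `\` W.
have mB k : measurable (B k) by apply: measurableD.
have B0 k : Lam (B k) = 0.
  have BU : B k `<=` U k by exact: subDsetl.
  exact: subset_measure0 BU (U0 k).
have B_cvg : (phi \o B) n @[n --> \oo] --> (0 : \bar R).
  have capB : \bigcap_k B k = set0.
    rewrite -subset0 => x Bx; have [_ nWx] := Bx 0%N I.
    by exfalso; apply: nWx => k _; case: (Bx k I).
  rewrite -(measure0 phi) -capB; apply: nonincreasing_cvg_mu => //.
  - by rewrite -ge0_fin_numE ?fin_num_measure //; exact: measure_ge0.
  - by rewrite capB.
  - by move=> n m nm; apply/subsetPset; apply: setSD; exact: U_noninc.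
have /choice[k hk] n : exists k, phi (B k) <= (1 / (2 ^ n.+1)%:R)%:E.
  have e0 : (0 < 1 / (2 ^ n.+1)%:R :> R)%R.
    by rewrite divr_gt0 // ltr0n expn_gt0.
  have [k _ hk] := cvge0_near_lt _ _ _ B_cvg e0.
  by exists k; apply/ltW; have := hk k (leqnn k).
(* [S^n V] is [S^(n+k) (S^-k V)] and [S^-k V] lies in [U k]; hence the index [n + k n] for
   [B (k n)]. *)
have [F [F1 F2 F3]] := cover_of_family X S A bijS R (fun n => B (k n))
  (fun n => n + k n)%N (fun n => mB (k n)).
have [G [G1 G2 G3]] := cover_of_set X S A bijS R W 0 mW.
have [FG1 FG2] := cover_sumU X S A bijS R phi G F G1 F1.
have [_ FG3] := cover_sumU X S A bijS R Lam G F G1 F1.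
exists (fun n => G n `|` F n); split => //.
- move=> n y Vy; rewrite bigcupU.
  have Uy : U 0%N y by exists 0%N.
  have [Wy|nWy] := pselect (W y).
    by left; apply: (G2 (iter n S y)); exact: WS.
  right; have [z zy] := iter_surj _ _ bijS (k n) y.
  rewrite -zy -iterD; apply: (F2 n); split.
    by rewrite -(addn0 (k n)) -US /= zy.
  by move=> /(WS (k n)); rewrite zy.
- apply: le_trans FG2 _; apply: leeD.
    by apply: le_trans (G3 phi) _; apply: le_measure; rewrite ?inE.
  apply: le_trans (F3 phi) _.
  apply: le_trans _ (epsilon_trick0 xpredT (@ler01 R)).
  by apply: lee_nneseries => // n _; exact: hk.
- apply: le_trans FG3 _; rewrite -(adde0 0); apply: leeD.
    have W0' : Lam W <= 0 by rewrite W0.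
    exact: le_trans (G3 Lam) W0'.
  by apply: le_trans (F3 Lam) _; rewrite eseries0 // => i _ _; exact: B0.
Qed.

Context (Z : T -> R).
Hypothesis Z_ge0 : forall x, (0 <= Z x)%R.
Hypothesis mZ : measurable_fun [set: T] Z.
Hypothesis Z_density : forall E : set T, measurable E ->
  Lam E = \int[phi]_(x in E) (Z x)%:E.

(** The sets [G k] with [M i <= k < M i.+1] are merged into one set at index [M i.+1]. By invariance
    its [Lam]-mass is at most a tail of the series of [G], so its part in [Z > 0] has small
    [phi]-mass. The finitely many [G k] with [k < M 0] are merged at index [M 0], at a cost of at
    most the whole [phi]-mass, and the shifts of [Z = 0] are left to [null_cover]. *)
Lemma bounded_cover (Q : set X) (G : nat -> set X) (s : R) : (0 < s)%R ->
  covers S A Q G -> cover_sum S Lam G < +oo ->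
  exists F, [/\ covers S A Q F,
    cover_sum S phi F <= phi setT + phi setT + 2%:E &
    cover_sum S Lam F <= cover_sum S Lam G + s%:E].
Proof.
move=> s0 [mG QG] Goo.
have {}mG n : measurable (iter n S @^-1` G n : set T) by exact/shifted_algebraP.
pose a n := Lam (iter n S @^-1` G n).
have a0 n : 0 <= a n by exact: measure_ge0.
have tail_cvg : \sum_(N <= k <oo) a k @[N --> \oo] --> (0 : \bar R).
  exact: (@nneseries_tail_cvg _ _ xpredT).
have e0 i : (0 < 1 / (2 ^ i.+1)%:R :> R)%R.
  by rewrite divr_gt0 // ltr0n expn_gt0.
have /choice[dl hdl] i : exists d, (0 < d)%R /\ forall E : set T, measurable E ->
    Lam E <= d%:E -> phi (E `&` [set x | (0 < Z x)%R]) <= (1 / (2 ^ i.+1)%:R)%:E.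
  have [d d0 hd] := abs_cont_on_support _ _ _ _ _ _ mZ Z_density _ (e0 i).
  by exists d.
have dl0 i : (0 < Num.min (dl i) (s / (2 ^ i.+1)%:R))%R.
  have [d0 _] := hdl i.
  by rewrite lt_min d0 divr_gt0 // ltr0n expn_gt0.
(* The term [dl i] controls the [phi]-mass of block [i]; the other makes the [Lam]-masses of all
   blocks sum to at most [s]. *)
have /choice[N hN] i : exists N, forall n, (N <= n)%N ->
    \sum_(n <= k <oo) a k <= (Num.min (dl i) (s / (2 ^ i.+1)%:R))%:E.
  have [N _ hN] := cvge0_near_lt _ _ _ tail_cvg (dl0 i).
  by exists N => n Nn; apply/ltW; have := hN n Nn.
(* Adding [i] makes [M] unbounded. [M] need not increase: for [k >= M 0], the least [j] with
   [k < M j] still satisfies [M j.-1 <= k], so [k] belongs to a block. *)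
pose M i := (N i + i)%N.
pose P m l k := (m <= k < l)%N.
pose C m l k : set T := if P m l k then iter l S @^-1` G k else set0.
pose B m l : set T := \bigcup_k C m l k.
have mC m l k : measurable (C m l k).
  rewrite /C; case: ifP => // /andP[_ /ltnW kl].
  have -> : iter l S @^-1` G k = iter (l - k) S @^-1` (iter k S @^-1` G k).
    by apply/seteqP; split=> x /=; rewrite -iterD subnKC.
  exact: measurable_preimage_iter.
have mB m l : measurable (B m l) by apply: bigcupT_measurable.
have LB m l : Lam (B m l) <= \sum_(m <= k <oo) a k.
  apply: (@le_trans _ _ (\sum_(k <oo) Lam (C m l k))).
    exact: measure_sigma_subadditive.
  rewrite [leRHS]eseries_cond [leRHS]eseries_mkcond /=.
  apply: lee_nneseries => k *; first exact: measure_ge0.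
  rewrite /C /P; case: ifP => [/andP[mk kl]|_].
    rewrite mk /a.
    have -> : iter l S @^-1` G k = iter (l - k) S @^-1` (iter k S @^-1` G k).
      by apply/seteqP; split=> x /=; rewrite -iterD subnKC // ltnW.
    by rewrite Lam_preimage_iter.
  by rewrite measure0; case: ifP.
pose D i : set T := B (M i) (M i.+1) `&` [set x | (0 < Z x)%R].
have mD i : measurable (D i).
  by apply: measurableI => //; exact: measurable_sub_gt.
have LBi i : Lam (B (M i) (M i.+1)) <=
    (Num.min (dl i) (s / (2 ^ i.+1)%:R))%:E.
  by apply: le_trans (LB _ _) _; apply: hN; exact: leq_addr.
have phiD i : phi (D i) <= (1 / (2 ^ i.+1)%:R)%:E.
  have [d0 h] := hdl i; apply: h => //.
  by apply: le_trans (LBi i) _; rewrite lee_fin ge_min lexx.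
have LD i : Lam (D i) <= (s / (2 ^ i.+1)%:R)%:E.
  apply: (@le_trans _ _ (Lam (B (M i) (M i.+1)))).
    by apply: le_measure; rewrite ?inE //; exact: subIsetl.
  by apply: le_trans (LBi i) _; rewrite lee_fin ge_min lexx orbT.
pose V : set T := [set x | (0 < Z x)%R].
have mV : measurable V by exact: measurable_sub_gt.
have V0 : Lam (~` V) = 0.
  rewrite Z_density; last exact: measurableC.
  rewrite integral0_eq // => x /= /negP; rewrite -leNgt => Zx.
  by congr EFin; apply/eqP; rewrite eq_le Zx Z_ge0.
have [F1 [mF1 hF1 phiF1 LF1]] := null_cover _ (measurableC mV) V0.
have [F2 [mF2 hF2 F2s]] := cover_of_family X S A bijS R D (fun i => M i.+1) mD.
have [F3 [mF3 hF3 F3s]] := cover_of_set X S A bijS R _ (M 0%N) (mB 0%N (M 0%N)).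
have [mF23 phiF23] := cover_sumU X S A bijS R phi F3 F2 mF3 mF2.
have [_ LF23] := cover_sumU X S A bijS R Lam F3 F2 mF3 mF2.
have [mF phiF] := cover_sumU X S A bijS R phi _ F1 mF23 mF1.
have [_ LF] := cover_sumU X S A bijS R Lam _ F1 mF23 mF1.
exists (fun n => F3 n `|` F2 n `|` F1 n); split.
- split => // x Qx; have [k _ Gx] := QG x Qx.
  rewrite !bigcupU.
  have exM : exists i, (k < M i)%N by exists k.+1; rewrite /M addnS ltnS leq_addl.
  case: (ex_minnP exM) => -[|i] ki imin.
    left; left; have [y yx] := iter_surj _ _ bijS (M 0%N) x.
    rewrite -yx; apply: hF3; exists k => //.
    by rewrite /C /P ki /= yx.
  have Mi : (M i <= k)%N by rewrite leqNgt; apply/negP => /imin; rewrite ltnn.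
  (* The point pulled back to index [M i.+1] decides: it lies either in the block where [Z > 0], or
     in the null set, all of whose shifts [F1] covers. *)
  have [y yx] := iter_surj _ _ bijS (M i.+1) x; rewrite -yx.
  have [Vy|nVy] := pselect (V y); last by right; exact: hF1.
  left; right; apply: (hF2 i); split => //; exists k => //.
  by rewrite /C /P Mi ki /= yx.
- apply: le_trans phiF _.
  (* One [phi setT + 1] pays for the initial sets and the blocks, the other for the null set. *)
  have -> : phi setT + phi setT + 2%:E = phi setT + 1 + (phi setT + 1).
    by rewrite addeACA -EFinD.
  apply: leeD => //; apply: le_trans phiF23 _; apply: leeD.
    by apply: le_trans (F3s phi) _; apply: le_measure; rewrite ?inE.
  apply: le_trans (F2s phi) _.
  apply: le_trans _ (epsilon_trick0 xpredT (@ler01 R)).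
  by apply: lee_nneseries => // n _; exact: phiD.
- apply: le_trans LF _; rewrite -[leRHS]adde0; apply: leeD => //.
  apply: le_trans LF23 _; apply: leeD.
    by apply: le_trans (F3s Lam) _; exact: LB.
  apply: le_trans (F2s Lam) _.
  apply: le_trans _ (epsilon_trick0 xpredT (ltW s0)).
  by apply: lee_nneseries => // n _; exact: LD.
Qed.

End invariant.

(** * Limits at 0 and moments *)

Lemma lim_at0_ereal_inf (R : realType) (f : R -> \bar R) :
  (forall e e', (0 < e)%R -> (e <= e')%R -> f e <= f e') ->
  lim (f e @[e --> 0%R^'+]) = ereal_inf [set f e | e in [set e | (0 < e)%R]].
Proof.
move=> f_mono; apply: cvg_lim => //.
have -> : [set e : R | (0 < e)%R] = `]0%R, +oo[%classic.
  by apply/seteqP; split=> x /=; rewrite in_itv/= andbT.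
apply: (nondecreasing_at_right_cvge (BInfty R false)) => // x y.
by rewrite !in_itv/= !andbT => x0 _; exact: f_mono.
Qed.

Lemma lim_at0_ereal_sup (R : realType) (f : R -> \bar R) :
  (forall e e', (0 < e)%R -> (e <= e')%R -> f e' <= f e) ->
  lim (f e @[e --> 0%R^'+]) = ereal_sup [set f e | e in [set e | (0 < e)%R]].
Proof.
move=> f_mono; apply: cvg_lim => //.
have -> : [set e : R | (0 < e)%R] = `]0%R, +oo[%classic.
  by apply/seteqP; split=> x /=; rewrite in_itv/= andbT.
apply: (nonincreasing_at_right_cvge (BInfty R false)) => // x y.
by rewrite !in_itv/= !andbT => x0 _; exact: f_mono.
Qed.

(** * Integration against a sum of restrictions of a measure *)

Section restricted_series.
Context d (T : measurableType d) (R : realType)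
  (phi : {measure set T -> \bar R}).

Lemma ge0_integral_mrestr (E : set T) (mE : measurable E) (h : T -> \bar R) :
  (forall x, 0 <= h x) -> measurable_fun [set: T] h ->
  \int[mrestr phi mE]_x h x = \int[phi]_(x in E) h x.
Proof.
move=> h0 mh; rewrite -(setUv E) ge0_integral_setU //; last 3 first.
- exact: measurableC.
- by rewrite setUv.
- by apply/disj_set2P; rewrite setICr.
rewrite [X in _ + X]null_set_integral ?adde0; last 3 first.
- exact: measurableC.
- exact: measurable_funTS.
- by change (phi (~` E `&` E) = 0); rewrite setICl measure0.
apply: eq_measure_integral => B mB BE.
by change (phi (B `&` E) = phi B); rewrite setIidl.
Qed.

Lemma integral_mrestr (E : set T) (mE : measurable E) (h : T -> \bar R) :
  measurable_fun [set: T] h ->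
  \int[mrestr phi mE]_x h x = \int[phi]_(x in E) h x.
Proof.
move=> mh; rewrite [LHS]integralE [in RHS]integralE.
by rewrite !ge0_integral_mrestr //; [exact: measurable_funeneg|exact: measurable_funepos].
Qed.

Context (E : nat -> set T) (mE : forall n, measurable (E n)).
Let m n : {measure set T -> \bar R} := mrestr phi (mE n).

Lemma ge0_integral_mseries_mrestr (h : T -> \bar R) :
  (forall x, 0 <= h x) -> measurable_fun [set: T] h ->
  \int[mseries m 0]_x h x = \sum_(n <oo) \int[phi]_(x in E n) h x.
Proof.
move=> h0 mh; rewrite ge0_integral_measure_series //.
by apply: eq_eseriesr => n _; rewrite ge0_integral_mrestr.
Qed.

(** The signed case serves [Z^x log Z]. Integrability against the sum gives it against each
    restriction, and makes the series of the positive and of the negative parts finite. *)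
Lemma integral_mseries_mrestr (h : T -> \bar R) :
  (mseries m 0).-integrable [set: T] h ->
  \int[mseries m 0]_x h x = \sum_(n <oo) \int[phi]_(x in E n) h x.
Proof.
move=> ih; have mh := measurable_int _ ih.
rewrite integral_measure_series //.
- by apply: eq_eseriesr => n _; rewrite integral_mrestr.
- move=> n; apply/integrableP; split => //.
  have /integrableP[_] := ih; apply: le_lt_trans.
  rewrite ge0_integral_measure_series //; last exact: measurableT_comp.
  rewrite (@nneseriesD1 _ _ n xpredT) //; last by move=> k _; exact: integral_ge0.
  by rewrite leeDl // nneseries_ge0 // => k _ _; exact: integral_ge0.
- have := integrable_neg_fin_num measurableT ih.
  rewrite ge0_integral_measure_series //; last exact: measurable_funeneg.
  rewrite ge0_fin_numE; last by apply: nneseries_ge0 => k _ _; exact: integral_ge0.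
  by under eq_eseriesr do rewrite -(gee0_abs (integral_ge0 _ _)) //.
- have := integrable_pos_fin_num measurableT ih.
  rewrite ge0_integral_measure_series //; last exact: measurable_funepos.
  rewrite ge0_fin_numE; last by apply: nneseries_ge0 => k _ _; exact: integral_ge0.
  by under eq_eseriesr do rewrite -(gee0_abs (integral_ge0 _ _)) //.
Qed.

End restricted_series.

(** * Moments of the density along a family of sets *)

Section moments.
Context d (T : measurableType d) (R : realType)
  (phi : {measure set T -> \bar R}) (Z : T -> R).
Hypothesis Z_ge0 : forall x, (0 <= Z x)%R.
Hypothesis mZ : measurable_fun [set: T] Z.
Context (E : nat -> set T) (mE : forall n, measurable (E n)) (K : R).
Hypothesis massK :
  \sum_(n <oo) phi (E n) + \sum_(n <oo) \int[phi]_(x in E n) (Z x)%:E <= K%:E.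

Let mu : {measure set T -> \bar R} :=
  mseries (fun n => mrestr phi (mE n) : {measure set T -> \bar R}) 0.

(** [1 + Z] dominates, up to constants, all the integrands [Z^x] and [Z^x log Z] with [0 < x < 1];
    its integral is the sum of the two masses in [massK]. *)
Let integral_affine : \int[mu]_x (1 + Z x)%:E <= K%:E.
Proof.
apply: le_trans massK; under eq_integral do rewrite EFinD.
rewrite ge0_integralD //; last 2 first.
- by move=> x _; rewrite lee_fin.
- exact/measurable_EFinP.
rewrite !ge0_integral_mseries_mrestr //; last exact/measurable_EFinP.
rewrite leeD2r // le_eqVlt; apply/orP; left; apply/eqP/eq_eseriesr => n _.
by rewrite integral_cst // mul1e.
Qed.

Let m_affine : measurable_fun [set: T] (fun x => 1 + Z x)%R.
Proof. exact: measurable_funD. Qed.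

Let integrable_affine : mu.-integrable [set: T] (EFin \o (fun x => 1 + Z x)%R).
Proof.
apply/integrableP; split; first exact/measurable_EFinP.
under eq_integral do rewrite gee0_abs ?lee_fin ?addr_ge0 //.
exact: le_lt_trans integral_affine (ltry _).
Qed.

Let integrable_dominated (h : T -> R) (C : R) :
  measurable_fun [set: T] h -> (forall x, `|h x| <= C * (1 + Z x))%R ->
  mu.-integrable [set: T] (EFin \o h).
Proof.
move=> mh hC.
have iC := integrableZl measurableT C integrable_affine.
apply: le_integrable iC => //; first exact/measurable_EFinP.
move=> x _ /=; rewrite lee_fin; apply: le_trans (hC x) _.
exact: ler_norm.
Qed.

Let Rintegral_affine : (\int[mu]_x (1 + Z x) <= K)%R.
Proof.
rewrite -lee_fin /Rintegral fineK //.
exact: integrable_fin_num.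
Qed.

Let sum_dominated (h : T -> R) (C : R) :
  measurable_fun [set: T] h -> (forall x, `|h x| <= C * (1 + Z x))%R ->
  \sum_(n <oo) \int[phi]_(x in E n) (h x)%:E = (\int[mu]_x h x)%R%:E.
Proof.
move=> mh hC; have ih := integrable_dominated _ _ mh hC.
rewrite /Rintegral fineK; last exact: integrable_fin_num.
by rewrite -integral_mseries_mrestr.
Qed.

Let mpow x : measurable_fun [set: T] (fun t => Z t `^ x)%R.
Proof. exact: (measurableT_comp (measurable_powR x) mZ). Qed.

Let mpowln x : measurable_fun [set: T] (fun t => Z t `^ x * ln (Z t))%R.
Proof.
apply: measurable_funM => //.
exact: (measurableT_comp (@measurable_ln R) mZ).
Qed.

Let pow_dom x t : (0 < x < 1)%R -> (`|Z t `^ x| <= 1 * (1 + Z t))%R.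
Proof. by move=> x01; rewrite mul1r ger0_norm ?powR_ge0 // powR_le1D. Qed.

Let powln_dom x t : (0 < x < 1)%R ->
  (`|Z t `^ x * ln (Z t)| <= pow_log_const R x * (1 + Z t))%R.
Proof. by move=> x01; rewrite powR_ln_bound. Qed.

(** When [E n] is the preimage of the n-th set of a cover, this and [log_moment] unfold to
    [power_sum] and [power_log_sum]. *)
Definition moment x := \sum_(n <oo) \int[phi]_(t in E n) (Z t `^ x)%:E.

Definition log_moment x :=
  \sum_(n <oo) \int[phi]_(t in E n) (Z t `^ x * ln (Z t))%:E.

Let momentE x : (0 < x < 1)%R -> moment x = (\int[mu]_t (Z t `^ x))%R%:E.
Proof. by move=> x01; apply: sum_dominated (fun t => pow_dom x t x01). Qed.

Let log_momentE x : (0 < x < 1)%R ->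
  log_moment x = (\int[mu]_t (Z t `^ x * ln (Z t)))%R%:E.
Proof. by move=> x01; apply: sum_dominated (fun t => powln_dom x t x01). Qed.

Lemma moment_fin x : (0 < x < 1)%R -> moment x \is a fin_num.
Proof. by move=> x01; rewrite momentE. Qed.

Lemma log_moment_fin x : (0 < x < 1)%R -> log_moment x \is a fin_num.
Proof. by move=> x01; rewrite log_momentE. Qed.

Lemma moment_ge0 x : 0 <= moment x.
Proof.
apply: nneseries_ge0 => n _ _; apply: integral_ge0 => t _.
by rewrite lee_fin powR_ge0.
Qed.

Lemma moment_le x : (0 < x < 1)%R -> moment x <= K%:E.
Proof.
move=> x01; rewrite momentE // lee_fin; apply: le_trans Rintegral_affine.
apply: le_Rintegral => // [|t _]; last by rewrite powR_le1D.
exact: integrable_dominated (fun t => pow_dom x t x01).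
Qed.

Lemma log_moment_bound x : (0 < x < 1)%R ->
  (`|fine (log_moment x)| <= pow_log_const R x * K)%R.
Proof.
move=> x01; rewrite log_momentE //=.
have ih := integrable_dominated _ _ (mpowln x) (fun t => powln_dom x t x01).
apply: le_trans (le_normr_Rintegral measurableT ih) _.
apply: (@le_trans _ _ (\int[mu]_t (pow_log_const R x * (1 + Z t)))%R).
  apply: le_Rintegral => //.
  - exact: integrable_norm.
  - exact: (integrableZl measurableT (pow_log_const R x) integrable_affine).
  - by move=> t _; exact: powln_dom.
rewrite RintegralZl // ler_wpM2l //.
exact: le_trans ler01 (pow_log_const_ge1 _ _ x01).
Qed.

Lemma moment_tangent_le x y : (0 < x < 1)%R -> (0 < y < 1)%R ->
  (fine (moment x) + fine (log_moment x) * (y - x) <= fine (moment y))%R.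
Proof.
move=> x01 y01; rewrite !momentE ?log_momentE //=.
have ix := integrable_dominated _ _ (mpow x) (fun t => pow_dom x t x01).
have iy := integrable_dominated _ _ (mpow y) (fun t => pow_dom y t y01).
have il := integrable_dominated _ _ (mpowln x) (fun t => powln_dom x t x01).
have ilc := integrableZr measurableT (y - x)%R il.
rewrite -RintegralZr // -RintegralD //; apply: le_Rintegral => //.
  exact: (integrableD measurableT ix ilc).
by move=> t _; exact: powR_tangent_le.
Qed.

(** Integrating [powR_le_taylor] turns the factor [1 + Z] into [K], so the remainder depends on the
    sets only through a bound on their masses. *)
Lemma moment_le_taylor x y : (0 < x < 1)%R -> (0 < y < 1)%R ->
  (fine (moment y) <= fine (moment x) + fine (log_moment x) * (y - x) +
     (y - x) ^+ 2 * (pow_log_const R x + pow_log_const R y) * K)%R.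
Proof.
move=> x01 y01; rewrite !momentE ?log_momentE //=.
have ix := integrable_dominated _ _ (mpow x) (fun t => pow_dom x t x01).
have iy := integrable_dominated _ _ (mpow y) (fun t => pow_dom y t y01).
have il := integrable_dominated _ _ (mpowln x) (fun t => powln_dom x t x01).
have ilc := integrableZr measurableT (y - x)%R il.
set c := ((y - x) ^+ 2 * (pow_log_const R x + pow_log_const R y))%R.
have c0 : (0 <= c)%R.
  have := pow_log_const_ge1 _ _ x01; have := pow_log_const_ge1 _ _ y01 => ? ?.
  by rewrite mulr_ge0 ?sqr_ge0 //; lra.
apply: (@le_trans _ _ (\int[mu]_t (Z t `^ x) +
    (\int[mu]_t (Z t `^ x * ln (Z t))) * (y - x) + c * \int[mu]_t (1 + Z t))%R).
  have ic := integrableZl measurableT c integrable_affine.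
  have ixl := integrableD measurableT ix ilc.
  rewrite -RintegralZr // -RintegralZl // -RintegralD // -RintegralD //.
  apply: le_Rintegral => //; first exact: (integrableD measurableT ixl ic).
  by move=> t _; exact: powR_le_taylor.
by rewrite lerD2l ler_wpM2l.
Qed.

End moments.

(** * The limits over near-optimal covers *)

Section near_optimal_covers.
Context (R : realType) (X : pointedType) (S : X -> X) (A : set (set X)).
Local Notation T := (g_sigma_algebraType (future_gens S A)).
Context (phi Lam : {finite_measure set T -> \bar R}).
Hypothesis bijS : bijective S.
Hypothesis Lam_inv : forall E : set T, measurable E -> Lam (S @^-1` E) = Lam E.
Context (Z : T -> R).
Hypothesis Z_ge0 : forall x, (0 <= Z x)%R.
Hypothesis mZ : measurable_fun [set: T] Z.
Hypothesis Z_density : forall E : set T, measurable E ->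
  Lam E = \int[phi]_(x in E) (Z x)%:E.
Context (Q : set X).

Let LQ := outer S A Lam Q.
Let PQ := PhiLambda S A Lam phi Q.
Let C e := covers01 S A Lam phi Q e.

Let cover_sum_ge0 (mu : {measure set T -> \bar R}) F : 0 <= cover_sum S mu F.
Proof. by apply: nneseries_ge0 => n _ _; exact: measure_ge0. Qed.

(** The whole space, put at index 0, covers [Q] with finite mass. *)
Lemma outer_fin : LQ \is a fin_num.
Proof.
rewrite ge0_fin_numE; last first.
  by apply: le_ereal_inf_tmp => _ [F _ <-]; exact: cover_sum_ge0.
have [F [F1 F2 F3]] := cover_of_set X S A bijS R setT 0 measurableT.
apply: (@le_lt_trans _ _ (Lam setT)); last first.
  by rewrite -ge0_fin_numE ?fin_num_measure //; exact: measure_ge0.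
apply: ge_ereal_inf; exists (cover_sum S Lam F); last exact: F3.
by exists F => //; split => // x _; exact: (F2 x).
Qed.

Let covers1_sub e e' : (e <= e')%R -> covers1 S A Lam Q e `<=` covers1 S A Lam Q e'.
Proof.
move=> ee F [cF FL]; split => //; apply: lt_le_trans FL _.
by apply: leeD => //; rewrite lee_fin.
Qed.

Lemma PhiLambdaE : PQ = ereal_sup
  [set ereal_inf [set cover_sum S phi F | F in covers1 S A Lam Q e]
  | e in [set e | (0 < e)%R]].
Proof.
apply: lim_at0_ereal_sup => e e' e0 ee; apply: ereal_inf_le_tmp.
exact: image_subset (covers1_sub _ _ ee).
Qed.

(** [bounded_cover] bounds the infimum by a constant independent of [e]. Half of [e] goes to the
    choice of a nearly optimal [G], half to the mass added in modifying it. *)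
Lemma PhiLambda_fin : PQ \is a fin_num.
Proof.
have inf_ge0 e : 0 <= ereal_inf [set cover_sum S phi F | F in covers1 S A Lam Q e].
  by apply: le_ereal_inf_tmp => _ [F _ <-]; exact: cover_sum_ge0.
rewrite ge0_fin_numE PhiLambdaE; last first.
  by apply: le_ereal_sup_tmp; eexists; [exists 1%R => //=; exact: ltr01|].
apply: (@le_lt_trans _ _ (phi setT + phi setT + 2%:E)); last first.
  by rewrite -ge0_fin_numE ?adde_ge0 // !fin_numD !fin_num_measure.
apply: ge_ereal_sup => _ [e /= e0 <-].
have e20 : (0 < e / 2)%R by lra.
have [G cG GL] : exists2 G, covers S A Q G & cover_sum S Lam G < LQ + (e / 2)%:E.
  have [|_ [G cG <-] GL] :=
      @ereal_inf_lt _ [set cover_sum S Lam F | F in covers S A Q] (LQ + (e / 2)%:E).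
    by rewrite -/(outer S A Lam Q) -/LQ lteDl ?lte_fin // outer_fin.
  by exists G.
have Goo : cover_sum S Lam G < +oo by apply: lt_le_trans GL (leey _).
have [F [cF phiF LF]] :=
  bounded_cover X S A R phi Lam bijS Lam_inv Z Z_ge0 mZ Z_density Q G _ e20 cG Goo.
apply: ge_ereal_inf; exists (cover_sum S phi F) => //; exists F => //; split => //.
apply: le_lt_trans LF _.
have -> : e%:E = (e / 2)%:E + (e / 2)%:E by rewrite -EFinD; congr EFin; field.
by rewrite addeA lteD2rE.
Qed.

Lemma covers01_sub e e' : (e <= e')%R -> C e `<=` C e'.
Proof.
move=> ee F [cF FP]; split; first exact: covers1_sub cF.
by apply: lt_le_trans FP _; apply: leeD => //; rewrite lee_fin.
Qed.

(** The infimum at level [e] is at most [PQ], and [PQ < PQ + e] because [PQ] is finite. *)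
Lemma covers01_neq0 e : (0 < e)%R -> exists F, C e F.
Proof.
move=> e0.
have : ereal_inf [set cover_sum S phi F | F in covers1 S A Lam Q e] < PQ + e%:E.
  apply: (@le_lt_trans _ _ PQ); last by rewrite lteDl ?lte_fin // PhiLambda_fin.
  by rewrite PhiLambdaE; apply: ereal_sup_ubound; exists e.
by move=> /ereal_inf_lt[_ [F cF <-] FP]; exists F.
Qed.

(** Each [+ 1] is the tolerance allowed to the members of [C 1]. *)
Let K : R := fine (PQ + 1 + (LQ + 1)).

Let E (F : nat -> set X) n : set T := iter n S @^-1` F n.

Lemma covers01_measurable e F : C e F -> forall n, measurable (E F n).
Proof. by move=> [[[mF _] _] _] n; exact/shifted_algebraP. Qed.

Lemma covers01_mass F : C 1 F -> \sum_(n <oo) phi (E F n) +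
  \sum_(n <oo) \int[phi]_(x in E F n) (Z x)%:E <= K%:E.
Proof.
move=> CF; have mF := covers01_measurable _ _ CF.
have -> : \sum_(n <oo) \int[phi]_(x in E F n) (Z x)%:E = cover_sum S Lam F.
  by apply: eq_eseriesr => n _; rewrite -Z_density.
case: CF => [[_ FL] FP].
rewrite /K fineK; last by rewrite !fin_numD PhiLambda_fin outer_fin.
by apply: leeD; exact: ltW.
Qed.

Let f F x := power_sum phi Z x F.
Let g F x := power_log_sum phi Z x F.
Let J x := calJ Lam phi Z Q x.
Let Th x := Theta Lam phi Z Q x.
Let N x e := coversF Lam phi Z Q x e.

Let f_fin F x : C 1 F -> (0 < x < 1)%R -> f F x \is a fin_num.
Proof.
move=> CF; exact: moment_fin Z_ge0 mZ _ (covers01_measurable _ _ CF) _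
  (covers01_mass _ CF) _.
Qed.

Let g_fin F x : C 1 F -> (0 < x < 1)%R -> g F x \is a fin_num.
Proof.
move=> CF; exact: log_moment_fin Z_ge0 mZ _ (covers01_measurable _ _ CF) _
  (covers01_mass _ CF) _.
Qed.

Let g_bound F x : C 1 F -> (0 < x < 1)%R -> (`|fine (g F x)| <= pow_log_const R x * K)%R.
Proof.
move=> CF; exact: log_moment_bound Z_ge0 mZ _ (covers01_measurable _ _ CF) _
  (covers01_mass _ CF) _.
Qed.

Let minr_le1 (e : R) : (0 < e)%R ->
  [/\ (0 < Num.min e 1)%R, (Num.min e 1 <= e)%R & (Num.min e 1 <= 1)%R].
Proof. by move=> e0; split; rewrite ?lt_min ?e0 ?ltr01 // ge_min lexx ?orbT. Qed.

Lemma calJE x : J x = ereal_inf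
  [set ereal_sup [set f F x | F in C e] | e in [set e | (0 < e)%R]].
Proof.
apply: lim_at0_ereal_inf => e e' e0 ee; apply: ereal_sup_le.
exact: image_subset (covers01_sub _ _ ee).
Qed.

Lemma calJ_fin x : (0 < x < 1)%R -> J x \is a fin_num.
Proof.
move=> x01; rewrite ge0_fin_numE calJE; last first.
  apply: le_ereal_inf_tmp => _ [e /= e0 <-].
  have [F CF] := covers01_neq0 _ e0.
  apply: le_ereal_sup_tmp; exists (f F x); first by exists F.
  exact: moment_ge0.
apply: (@le_lt_trans _ _ K%:E); last exact: ltry.
apply: ge_ereal_inf; exists (ereal_sup [set f F x | F in C 1]).
  by exists 1%R => //=; exact: ltr01.
apply: ge_ereal_sup => _ [F CF <-].
exact: moment_le Z_ge0 mZ _ (covers01_measurable _ _ CF) _ (covers01_mass _ CF) _ x01.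
Qed.

Let coversF_sub x e e' : (0 < x < 1)%R -> (e <= e')%R -> N x e `<=` N x e'.
Proof.
move=> x01 ee F [CF FJ]; split; first exact: covers01_sub CF.
by apply: le_lt_trans FJ; rewrite leeB // lee_fin.
Qed.

Lemma ThetaE x : (0 < x < 1)%R -> Th x = ereal_sup
  [set ereal_inf [set g F x | F in N x e] | e in [set e | (0 < e)%R]].
Proof.
move=> x01; apply: lim_at0_ereal_sup => e e' e0 ee; apply: ereal_inf_le_tmp.
exact: image_subset (coversF_sub _ _ _ x01 ee).
Qed.

Lemma coversF_neq0 x e : (0 < x < 1)%R -> (0 < e)%R -> exists F, N x e F.
Proof.
move=> x01 e0; have Jfin := calJ_fin _ x01.
have : J x - e%:E < ereal_sup [set f F x | F in C e].
  apply: (@lt_le_trans _ _ (J x)).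
    by rewrite lteBlDr // lteDl // lte_fin.
  by rewrite [leLHS]calJE; apply: ereal_inf_lbound; exists e.
by move=> /ereal_sup_gt[_ [F CF <-] FJ]; exists F.
Qed.

Lemma Theta_fin x : (0 < x < 1)%R -> Th x \is a fin_num.
Proof.
move=> x01; rewrite fin_numElt; apply/andP; split; rewrite ThetaE //.
  apply: (@lt_le_trans _ _ (- (pow_log_const R x * K))%:E); first exact: ltNyr.
  apply: le_ereal_sup_tmp; exists (ereal_inf [set g F x | F in N x 1]).
    by exists 1%R => //=; exact: ltr01.
  apply: le_ereal_inf_tmp => _ [F [CF _] <-].
  rewrite -(fineK (g_fin _ _ CF x01)) lee_fin.
  by have := g_bound _ _ CF x01; rewrite ler_norml => /andP[].
apply: (@le_lt_trans _ _ (pow_log_const R x * K)%:E); last exact: ltry.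
apply: ge_ereal_sup => _ [e /= e0 <-].
have [m0 me m1] := minr_le1 _ e0.
have [F NF] := coversF_neq0 _ _ x01 m0.
apply: ge_ereal_inf; exists (g F x); first by exists F => //; exact: coversF_sub NF.
have CF : C 1 F by case: NF => CF _; exact: covers01_sub CF.
rewrite -(fineK (g_fin _ _ CF x01)) lee_fin.
exact: le_trans (ler_norm _) (g_bound _ _ CF x01).
Qed.

(** The truncation at 1 puts every [D e] inside [C 1], where the moments are finite and bounded
    uniformly. *)
Let D (e : R) : set (nat -> set X) := C (Num.min e 1%R).

Let D1 e F : (0 < e)%R -> D e F -> C 1 F.
Proof. by move=> /minr_le1[_ _ m1]; exact: covers01_sub. Qed.

Let D_mono e e' : (0 < e)%R -> (e <= e')%R -> D e `<=` D e'.
Proof.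
move=> e0 ee; apply: covers01_sub.
by rewrite le_min !ge_min ee lexx !orbT.
Qed.

Let D_one F : D 1 F -> C 1 F.
Proof. exact: D1. Qed.

Let f_tangent F x y : D 1 F -> (0 < x < 1)%R -> (0 < y < 1)%R ->
  (fine (f F x) + fine (g F x) * (y - x) <= fine (f F y))%R.
Proof.
move=> /D_one CF; exact: moment_tangent_le Z_ge0 mZ _ (covers01_measurable _ _ CF) _
  (covers01_mass _ CF) _ _.
Qed.

Let K_ge0 : (0 <= K)%R.
Proof.
have [F CF] := covers01_neq0 _ (@ltr01 R).
rewrite -lee_fin; apply: le_trans (covers01_mass _ CF).
rewrite adde_ge0 //; apply: nneseries_ge0 => n _ _.
  exact: measure_ge0.
by apply: integral_ge0 => x _; rewrite lee_fin.
Qed.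

(** On [[a/2, a]] the term [4 / y^2] is largest at [a/2] and [4 / (1-y)^2] at [a]. This makes the
    constants of the envelope hypotheses uniform in [y]. *)
Let pow_log_const_le (a y : R) : (0 < a < 1)%R -> (a / 2 <= y <= a)%R ->
  (0 < y < 1)%R /\ (pow_log_const R y <= 1 + 4 / (a / 2) ^+ 2 + 4 / (1 - a) ^+ 2)%R.
Proof.
move=> /andP[a0 a1] /andP[ya ay]; split; first by apply/andP; split; lra.
rewrite /pow_log_const lerD // ?lerD2l // ler_pM2l // lef_pV2 ?posrE ?exprn_gt0 //;
  try lra.
  by rewrite ler_sqr ?nnegrE //; lra.
by rewrite ler_sqr ?nnegrE //; lra.
Qed.

Let f_taylor a : (0 < a < 1)%R -> exists2 K', (0 <= K')%R &
  forall F y, D 1 F -> (a / 2 <= y <= a)%R ->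
  (fine (f F y) <= fine (f F a) + fine (g F a) * (y - a) + K' * (y - a) ^+ 2)%R.
Proof.
move=> a01; set B := (1 + 4 / (a / 2) ^+ 2 + 4 / (1 - a) ^+ 2)%R.
have ca := pow_log_const_ge1 _ _ a01.
have a2 : (a / 2 <= a <= a)%R by move/andP: a01 => [? ?]; apply/andP; split; lra.
have [_ cB] := pow_log_const_le _ _ a01 a2; rewrite -/B in cB.
exists ((pow_log_const R a + B) * K)%R; first by rewrite mulr_ge0 //; lra.
move=> F y /D_one CF ya; have [y01 yB] := pow_log_const_le _ _ a01 ya.
apply: le_trans (moment_le_taylor _ _ _ _ _ Z_ge0 mZ _ (covers01_measurable _ _ CF) _
  (covers01_mass _ CF) a y a01 y01) _.
rewrite lerD2l -mulrA mulrC ler_wpM2r ?sqr_ge0 // ler_wpM2r //.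
by rewrite lerD2l.
Qed.

Let g_lb a : (0 < a < 1)%R -> exists2 K', (0 <= K')%R &
  forall F y, D 1 F -> (a / 2 <= y <= a)%R -> (- K' <= fine (g F y))%R.
Proof.
move=> a01; set B := (1 + 4 / (a / 2) ^+ 2 + 4 / (1 - a) ^+ 2)%R.
have ca := pow_log_const_ge1 _ _ a01.
have a2 : (a / 2 <= a <= a)%R by move/andP: a01 => [? ?]; apply/andP; split; lra.
have [_ cB] := pow_log_const_le _ _ a01 a2; rewrite -/B in cB.
exists (B * K)%R; first by rewrite mulr_ge0 //; lra.
move=> F y /D_one CF ya; have [y01 yB] := pow_log_const_le _ _ a01 ya.
have := g_bound _ _ CF y01; rewrite ler_norml => /andP[+ _].
by apply: le_trans; rewrite lerN2 ler_wpM2r.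
Qed.

Let J_ub x e : (0 < x < 1)%R -> (0 < e)%R -> exists2 dl, (0 < dl)%R &
  forall F, D dl F -> (fine (f F x) < fine (J x) + e)%R.
Proof.
move=> x01 e0; have Jfin := calJ_fin _ x01.
have : J x < J x + e%:E by rewrite lteDl // lte_fin.
rewrite [X in X < _]calJE => /ereal_inf_lt[_ [dl /= dl0 <-] supJ].
exists dl => // F DF; have CF := D1 _ _ dl0 DF.
rewrite -lte_fin EFinD !fineK //; last exact: f_fin.
apply: le_lt_trans supJ; apply: ereal_sup_ubound; exists F => //.
by have [_ h _] := minr_le1 _ dl0; exact: covers01_sub DF.
Qed.

Let Th_attained x e : (0 < x < 1)%R -> (0 < e)%R -> exists F,
  [/\ D e F, (fine (J x) - e < fine (f F x))%R & (fine (g F x) < fine (Th x) + e)%R].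
Proof.
move=> x01 e0; have Jfin := calJ_fin _ x01; have Tfin := Theta_fin _ x01.
have [m0 me m1] := minr_le1 _ e0.
have : ereal_inf [set g F x | F in N x (Num.min e 1%R)] < Th x + e%:E.
  apply: (@le_lt_trans _ _ (Th x)); last by rewrite lteDl // lte_fin.
  by rewrite [leRHS]ThetaE //; apply: ereal_sup_ubound; exists (Num.min e 1%R).
move=> /ereal_inf_lt[_ [F [DF JF] <-] gF]; have CF := D1 _ _ e0 DF.
have ffin := f_fin _ _ CF x01; have gfin := g_fin _ _ CF x01.
exists F; split => //; last by rewrite -lte_fin EFinD !fineK.
rewrite -lte_fin EFinB !fineK //; apply: le_lt_trans JF.
by rewrite leeB // lee_fin.
Qed.

Let Th_lb x e : (0 < x < 1)%R -> (0 < e)%R -> exists2 dl, (0 < dl)%R &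
  forall F, D dl F -> (fine (J x) - dl < fine (f F x))%R ->
  (fine (Th x) - e < fine (g F x))%R.
Proof.
move=> x01 e0; have Jfin := calJ_fin _ x01; have Tfin := Theta_fin _ x01.
have : Th x - e%:E < Th x by rewrite lteBlDr // lteDl // lte_fin.
rewrite [X in _ < X]ThetaE // => /ereal_sup_gt[_ [dl /= dl0 <-] infT].
exists dl => // F DF JF; have CF := D1 _ _ dl0 DF.
have ffin := f_fin _ _ CF x01; have gfin := g_fin _ _ CF x01.
rewrite -lte_fin EFinB !fineK //; apply: lt_le_trans infT _.
apply: ereal_inf_lbound; exists F => //; split.
  by have [_ h _] := minr_le1 _ dl0; exact: covers01_sub DF.
rewrite -/(J x) -/(f F x).
by rewrite -(fineK Jfin) -EFinB -(fineK ffin) lte_fin.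
Qed.

Lemma near_left01 (a : R) : (0 < a < 1)%R -> \forall x \near a^'-, (0 < x < 1)%R.
Proof.
move=> /andP[a0 a1]; near=> x; apply/andP; split.
  by near: x; exact: nbhs_left_gt.
by apply: lt_trans a1; near: x; exact: nbhs_left_lt.
Unshelve. all: by end_near. Qed.

Lemma calJ_left_derivative a : (0 < a < 1)%R -> is_left_derivative J a (Th a).
Proof.
move=> a01; split; [exact: calJ_fin| |exact: Theta_fin|].
  by apply: filterS (near_left01 _ a01) => x; exact: calJ_fin.
apply/cvgrPdist_le => e e0.
(* All quantities are finite on (0, 1), so the real-valued envelope result applies to their [fine]
   parts. *)
have [dl dl0 h] := envelope_left_derivative R _ D (fun F x => fine (f F x))
  (fun F x => fine (g F x)) (fun x => fine (J x)) (fun x => fine (Th x))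
  D_mono f_tangent f_taylor g_lb J_ub Th_attained Th_lb a e a01 e0.
near=> x.
have x01 : (0 < x < 1)%R by near: x; exact: near_left01.
have xa : (a - dl < x < a)%R.
  apply/andP; split; near: x; first by apply: nbhs_left_gt; lra.
  exact: nbhs_left_lt.
have /andP[h1 h2] := h x xa x01.
rewrite ler_distlC; apply/andP; split => //.
by apply: le_trans h2 _; rewrite lerDl ltW.
Unshelve. all: by end_near. Qed.

Lemma Theta_left_continuous a : (0 < a < 1)%R ->
  Th x @[x --> a^'-] --> Th a.
Proof.
move=> a01; rewrite -(fineK (Theta_fin _ a01)); apply/fine_cvgP; split.
  by apply: filterS (near_left01 _ a01) => x; exact: Theta_fin.
apply/cvgrPdist_le => e e0.
have [dl dl0 h] := envelope_slope_left_continuous R _ D (fun F x => fine (f F x))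
  (fun F x => fine (g F x)) (fun x => fine (J x)) (fun x => fine (Th x))
  D_mono f_tangent f_taylor g_lb J_ub Th_attained Th_lb a e a01 e0.
near=> x.
have x01 : (0 < x < 1)%R by near: x; exact: near_left01.
have xa : (a - dl < x < a)%R.
  apply/andP; split; near: x; first by apply: nbhs_left_gt; lra.
  exact: nbhs_left_lt.
have /andP[h1 h2] := h x xa x01.
move: h1 h2 => /= h1 h2.
rewrite ler_distlC.
apply/andP; split; first exact: h1.
apply: le_trans h2 _.
by rewrite lerDl ltW.
Unshelve. all: by end_near. Qed.

End near_optimal_covers.

Theorem theorem7 (R : realType) (X : pointedType) (S : X -> X)
    (bijS : bijective S)
    (A : set (set X)) (sigmaA : sigma_algebra [set: X] A)
    (phi0 Lambda : {finite_measure
       set (g_sigma_algebraType (future_gens S A)) -> \bar R})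
    (Lambda_inv : forall E : set X, <<s future_gens S A >> E ->
       Lambda (S @^-1` E) = Lambda E)
    (Lambda_dom : Lambda `<< phi0)
    (Z : g_sigma_algebraType (future_gens S A) -> R)
    (Z_ge0 : forall x, (0 <= Z x)%R)
    (Z_meas : measurable_fun [set: g_sigma_algebraType (future_gens S A)] Z)
    (Z_density : forall E : set X, <<s future_gens S A >> E ->
       Lambda E = \int[phi0]_(x in E) (Z x)%:E)
    (Q : set X) (QB : <<s two_sided_gens S A >> Q)
    (alpha : R) (alpha_gt0 : (0 < alpha)%R) (alpha_lt1 : (alpha < 1)%R) :
  is_left_derivative (calJ Lambda phi0 Z Q) alpha
    (Theta Lambda phi0 Z Q alpha) /\
  Theta Lambda phi0 Z Q x @[x --> alpha^'-] --> Theta Lambda phi0 Z Q alpha.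

Proof.
have a01 : (0 < alpha < 1)%R by rewrite alpha_gt0.
split.
  exact: calJ_left_derivative bijS Lambda_inv Z Z_ge0 Z_meas Z_density Q _ a01.
exact: Theta_left_continuous bijS Lambda_inv Z Z_ge0 Z_meas Z_density Q _ a01.
Qed.
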